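(* $\mathrm{non}({\sf S}_1(\Gamma,\Omega))=\mathfrak{d}$; that is, the minimum cardinality of a set of real numbers which fails to have property ${\sf S}_1(\Gamma,\Omega)$ equals $\mathfrak{d}$.
   Context: ''Cover'' means countable open cover. For a set $X$ of reals, a cover $\mathcal{U}$ of $X$ is an $\omega$-cover if $X\notin\mathcal{U}$ and every finite subset of $X$ is contained in some member of $\mathcal{U}$; it is a $\gamma$-cover if it is infinite and each $x\in X$ fails to belong to only finitely many members. $X$ has ${\sf S}_1(\Gamma,\Omega)$ if for every sequence $(\mathcal{U}_n)$ of $\gamma$-covers of $X$ one can choose $U_n\in\mathcal{U}_n$ such that $\{U_n:n\in\omega\}$ is an $\omega$-cover of $X$. $\mathfrak{d}$ is the minimal cardinality of a dominating family in $\omega^\omega$ (a family such that every $g\in\omega^\omega$ is eventually dominated by some member). *)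

(* Defs.v *)
From mathcomp Require Import all_boot all_order all_algebra.
From mathcomp Require Import all_classical all_reals all_analysis.
Import Order.TTheory GRing.Theory Num.Theory.
Import numFieldNormedType.Exports.

Set Implicit Arguments.
Unset Strict Implicit.
Unset Printing Implicit Defensive.

Local Open Scope classical_set_scope.
Local Open Scope card_scope.

(* X is viewed as a subspace of R: the members of a cover of X are the
   relatively open subsets of X (traces on X of open sets of reals), so that
   the condition X \notin U in the definition of omega-covers is meaningful.
   In particular a finite X has no gamma-cover. *)
Definition relatively_open {R : realType} (X U : set R) : Prop :=
  exists2 O : set R, open O & U = X `&` O.

Definition is_cover {R : realType} (X : set R) (Us : set (set R)) : Prop :=
  [/\ countable Us,
      forall U, Us U -> relatively_open X U
    & \bigcup_(U in Us) U = X].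

Definition omega_cover {R : realType} (X : set R) (Us : set (set R)) : Prop :=
  [/\ is_cover X Us,
      ~ Us X
    & forall F : set R, finite_set F -> F `<=` X ->
        exists2 U, Us U & F `<=` U].

Definition gamma_cover {R : realType} (X : set R) (Us : set (set R)) : Prop :=
  [/\ is_cover X Us,
      infinite_set Us
    & forall x, X x -> finite_set [set U | Us U /\ ~ U x]].

Definition S1 {T : Type} (A B : set (set T)) : Prop :=
  forall Us : nat -> set T, (forall n, A (Us n)) ->
    exists2 U : nat -> T, forall n, Us n (U n) & B (range U).

Definition S1_Gamma_Omega {R : realType} (X : set R) : Prop :=
  S1 (gamma_cover X) (omega_cover X).

Definition dominating (D : set (nat -> nat)) : Prop :=
  forall g : nat -> nat,
    exists2 f, D f & \forall n \near \oo, (g n <= f n)%N.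

(* "The minimum of the cardinalities of the members of C exists and is |K|":
   a cardinal number is represented by any set K of that cardinality. *)
Definition is_min_card {T V : Type} (C : set (set T)) (K : set V) : Prop :=
  (exists2 A, C A & A #= K) /\ (forall A, C A -> K #<= A).

(* Main.v *)
Require Import Defs.
From mathcomp Require Import all_boot all_order all_algebra.
From mathcomp Require Import all_classical all_reals all_analysis.
From mathcomp Require Import ring lra.
Import Order.TTheory GRing.Theory Num.Theory.
Import numFieldNormedType.Exports.

(** If [X] fails S_1(Gamma,Omega), witnessed by gamma-covers enumerated as
    U_n^0, U_n^1, ..., send a finite F included in X to the function mapping n
    to an index beyond which every U_n^k contains F. If some g were dominated by
    none of these functions, the sets U_n^(g n) would form an omega-cover. So
    the finite subsets of X index a dominating family, and the infinite X has as
    many finite subsets as points.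

    Conversely, code each f of a dominating family D by a real x_f such that
    "f n <= k" is an open condition on x_f. The sets
    U_n^k = {x_f | f n <= k} form gamma-covers for n large, and no choice of
    U_n^(g n) is an omega-cover: if f dominates g.+1, the point x_f lies in
    only finitely many of the chosen sets, each of which misses a point of X;
    these points and x_f form a finite set contained in no chosen set. *)

Local Open Scope classical_set_scope.
Local Open Scope card_scope.
Local Open Scope ring_scope.

(** * Comparison of cardinals: minima and totality *)

Lemma card_leP_fun {T : Type} {U : pointedType} {A : set T} {B : set U} :
  A #<= B <-> exists f : T -> U, (forall x, A x -> B (f x)) /\
    (forall x y, A x -> A y -> f x = f y -> x = y).
Proof.
split=> [/pcard_leP/injfunPex[f fAB finj]|[f [fAB finj]]].
  by exists f; split=> // x y Ax Ay; apply: finj; exact/mem_set.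
apply/pcard_leP/injfunPex; exists f => // x y /set_mem Ax /set_mem Ay.
exact: finj.
Qed.

(* Honig's argument: take a maximal set of choice functions on C that pairwise
   disagree at every coordinate; by maximality the values of these functions
   exhaust some coordinate A, so that A injects into every other one. *)
Lemma card_min_exists {T : Type} (C : set (set T)) : C !=set0 ->
  exists2 A, C A & forall B, C B -> A #<= B.
Proof.
move=> C0.
pose P (S : set (set T -> T)) := forall B, C B ->
  (forall s, S s -> B (s B)) /\
  (forall s t, S s -> S t -> s B = t B -> s = t).
have [F FP totF|S [PS Smax]] := @Zorn_bigcup _ P.
  move=> B CB; split=> [s [S FS Ss]|s t [S FS Ss] [S' FS' S't] st].
    by have [/(_ s Ss)] := FP _ FS _ CB.
  have [SS'|S'S] := totF _ _ FS FS'.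
    by have [_] := FP _ FS' _ CB; apply=> //; exact: SS'.
  by have [_] := FP _ FS _ CB; apply=> //; exact: S'S.
have [A CA SA] : exists2 A, C A & A `<=` [set s A | s in S].
  apply: contrapT => noA.
  have exv B : exists v, C B -> B v /\ ~ [set s B | s in S] v.
    have [CB|nCB] := pselect (C B); last first.
      (* Off [C] any value serves; if none existed, [T] would be empty and [B0] vacuously
         exhausted. *)
      have [B0 CB0] := C0; apply: contrapT => nov.
      by apply: noA; exists B0 => // v _; case: nov; exists v.
    apply: contrapT => nov; apply: noA; exists B => // v Bv.
    by apply: contrapT => nv; apply: nov; exists v.
  have [t tP] := choice exv.
  have nSt : ~ S t.
    by move=> St; have [B CB] := C0; have [_] := tP _ CB; apply; exists t.
  apply: (Smax (S `|` [set t])).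
    split; first by move=> s Ss; left.
    by move=> /(_ t) h; apply/nSt/h; right.
  move=> B CB; have [SB Sinj] := PS _ CB; have [tB tS] := tP _ CB.
  split=> [s [/SB//|->//]|s s' [Ss|->] [Ss'|->]//] e.
  - exact: Sinj.
  - by case: tS; exists s.
  - by case: tS; exists s'.
exists A => // B CB; apply: (card_le_trans (B := S)).
  exact: card_le_trans (subset_card_le SA) (card_image_le _ _).
have [SB Sinj] := PS _ CB.
suff /injfunPex[f] : exists2 f : (set T -> T) -> T, set_fun S B f & set_inj S f.
  exact: inj_card_le.
exists (fun s => s B) => // s t /set_mem Ss /set_mem St.
exact: Sinj.
Qed.

Lemma card_le_total {T : Type} (A B : set T) : A #<= B \/ B #<= A.
Proof.
have [|D [->|->] h] := @card_min_exists T [set A; B].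
- by exists A; left.
- by left; apply: h; right.
- by right; apply: h; left.
Qed.

(** * Squares and finite sequences of an infinite set *)

(* A relation [G] encodes an injection of [B `*` B] into [B], where [B] is the
   set of the [x] such that [(x, x)] is in the domain of [G]. *)
Definition square_dom {T : Type} (G : set (T * T * T)) : set T :=
  [set x | exists z, G (x, x, z)].

Definition square_inj {T : Type} (X : set T) (G : set (T * T * T)) : Prop :=
  [/\ square_dom G `<=` X,
      forall x y, square_dom G x -> square_dom G y -> exists z, G (x, y, z),
      forall x y z, G (x, y, z) ->
        [/\ square_dom G x, square_dom G y & square_dom G z],
      forall p z z', G (p, z) -> G (p, z') -> z = z'
    & forall p p' z, G (p, z) -> G (p', z) -> p = p'].

(** Let [B] be the domain and [j] copy [B] into its complement in [X]. The square of the union of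
    [B] and [j B] consists of [B] squared, where [G] is kept, and three further copies of it. These
    are sent into [j B], hence away from the values of [G]: [p] codes the pair and [i (2 * s + t)]
    records which copy it came from. *)
Lemma square_inj_extend {T : pointedType} (X : set T) (G : set (T * T * T)) :
    square_inj X G -> infinite_set (square_dom G) ->
    square_dom G #<= X `\` square_dom G ->
  exists G', [/\ square_inj X G', G `<=` G' & ~ G' `<=` G].
Proof.
set B := square_dom G; move=> [BX Gtot GB Gfun Ginj] Binf.
move=> /card_leP_fun[j [jX jinj]].
have /infiniteP/card_leP_fun[i [iB' iinj']] := Binf.
have iB n : B (i n) by exact: iB'.
have iinj m n : i m = i n -> m = n by exact: iinj'.
have exp (xy : T * T) : exists z, B xy.1 -> B xy.2 -> G (xy, z).
  have [[Bx By]|nB] := pselect (B xy.1 /\ B xy.2).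
    by have [z Gz] := Gtot _ _ Bx By; exists z => _ _; case: xy Bx By Gz.
  by exists point => Bx By; case: nB.
have [p' pG'] := choice exp; pose p x y := p' (x, y).
have pG x y : B x -> B y -> G (x, y, p x y) by move=> Bx By; exact: (pG' (x, y)).
have pB x y : B x -> B y -> B (p x y).
  by move=> Bx By; have [] := GB _ _ _ (pG _ _ Bx By).
have pinj x y x' y' : B x -> B y -> B x' -> B y' -> p x y = p x' y' ->
    x = x' /\ y = y'.
  move=> Bx By Bx' By' e; have := pG _ _ Bx By; rewrite e => h.
  by have [] := Ginj _ _ _ h (pG _ _ Bx' By').
pose e (s : bool) u := if s then j u else u.
have einj s u t v : B u -> B v -> e s u = e t v -> s = t /\ u = v.
  case: s; case: t => //= Bu Bv.
  - by move=> /jinj ->.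
  - by move=> h; have [] := jX _ Bu; rewrite h.
  - by move=> h; have [] := jX _ Bv; rewrite -h.
pose q s u t v := j (p (p u v) (i (2 * s + t)%N)).
pose G1 := [set w | exists s u t v, [/\ B u, B v, s || t
  & w = (e s u, e t v, q s u t v)]].
have qB s u t v : B u -> B v -> B (p (p u v) (i (2 * s + t)%N)).
  by move=> Bu Bv; apply: (pB) => //; exact: pB.
pose E := [set x | exists s u, B u /\ x = e s u].
have domE : square_dom (G `|` G1) = E.
  apply/seteqP; split=> x.
    move=> [z [Gxz|[s [u [t [v [Bu Bv st [-> _ _]]]]]]]].
      by exists false, x; split=> //; exists z.
    by exists s, u.
  move=> [[] [u [Bu ->]]].
    by exists (q true u true u); right; exists true, u, true, u.
  by have [z Gz] := Bu; exists z; left.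
have GE x : B x -> E x by move=> Bx; exists false, x.
exists (G `|` G1); rewrite /square_inj domE; split.
- split.
  + by move=> x [[] [u [Bu ->]]]; [have [] := jX _ Bu|exact: BX].
  + move=> x y [s [u [Bu ->]]] [t [v [Bv ->]]].
    have [st|] := boolP (s || t).
      by exists (q s u t v); right; exists s, u, t, v.
    rewrite negb_or => /andP[/negbTE -> /negbTE ->] /=.
    by exists (p u v); left; exact: pG.
  + move=> x y z [/GB[Bx By Bz]|]; first by split; exact: GE.
    move=> [s [u [t [v [Bu Bv st [-> -> ->]]]]]]; split.
    * by exists s, u.
    * by exists t, v.
    * by exists true, (p (p u v) (i (2 * s + t)%N)); split=> //; exact: qB.
  + have G_G1 x y z z' : G (x, y, z) -> G1 (x, y, z') -> False.
      move=> /GB[Bx By _] [s [u [t [v [Bu Bv st [xe ye _]]]]]].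
      have [sE _] := einj false x s u Bx Bu xe.
      have [tE _] := einj false y t v By Bv ye.
      by rewrite -sE -tE in st.
    move=> [x y] z z' [Gz|Gz] [Gz'|Gz'].
    * exact: Gfun Gz Gz'.
    * by have := G_G1 _ _ _ _ Gz Gz'.
    * by have := G_G1 _ _ _ _ Gz' Gz.
    move: Gz Gz' => [s [u [t [v [Bu Bv st [-> -> ->]]]]]].
    move=> [s' [u' [t' [v' [Bu' Bv' st' [+ + ->]]]]]].
    by move=> /(einj _ _ _ _ Bu Bu')[-> ->] /(einj _ _ _ _ Bv Bv')[-> ->].
  + have G_G1 w w' z : G (w, z) -> G1 (w', z) -> False.
      case: w => x y /GB[_ _ Bz] [s [u [t [v [Bu Bv st [_ ze]]]]]].
      by have [_] := jX _ (qB s u t v Bu Bv); apply; rewrite -[j _]ze.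
    move=> w w' z [Gz|Gz] [Gz'|Gz'].
    * exact: Ginj Gz Gz'.
    * by have := G_G1 _ _ _ Gz Gz'.
    * by have := G_G1 _ _ _ Gz' Gz.
    move: Gz Gz' => [s [u [t [v [Bu Bv st [-> ->]]]]]].
    move=> [s' [u' [t' [v' [Bu' Bv' st' [-> ]]]]]].
    move=> /jinj - /(_ (qB _ _ _ _ Bu Bv) (qB _ _ _ _ Bu' Bv')).
    move=> /pinj[]; rewrite ?iB//; try exact: pB.
    move=> /pinj[]// -> -> /iinj.
    by case: s st; case: t; case: s' st'; case: t'.
- by move=> w; left.
- move=> /(_ (j (i 0%N), j (i 0%N), q true (i 0%N) true (i 0%N))) GG.
  suff /GB[Bj _ _] : G (j (i 0%N), j (i 0%N), q true (i 0%N) true (i 0%N)).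
    by have [] := jX _ (iB 0%N).
  by apply: GG; right; exists true, (i 0%N), true, (i 0%N).
Qed.

(** Take a maximal relation, with domain [B]. By maximality [B] does not embed into its complement,
    so the complement embeds into [B]; then [X] embeds into two copies of [B], hence into [B]
    squared and into [B]. *)
Lemma card_le_setX_infinite {T : pointedType} (X : set T) :
  infinite_set X -> X `*` X #<= X.
Proof.
move=> /infiniteP/card_leP_fun[i [iX' iinj']].
have iX n : X (i n) by exact: iX'.
have iinj m n : i m = i n -> m = n by exact: iinj'.
pose G0 := [set w | exists m n, w = (i m, i n, i (pickle (m, n)))].
have domG0 m : square_dom G0 (i m) by exists (i (pickle (m, m))), m, m.
have G0P : square_inj X G0.
  split.
  - by move=> x [z [m [n [-> _ _]]]].
  - move=> x y [z [m [_ [-> _ _]]]] [z' [n [_ [-> _ _]]]].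
    by exists (i (pickle (m, n))), m, n.
  - by move=> x y z [m [n [-> -> ->]]].
  - move=> p z z' [m [n [-> ->]]] [m' [n' [+ + ->]]].
    by move=> /iinj -> /iinj ->.
  - move=> p p' z [m [n [-> ->]]] [m' [n' [-> /iinj]]].
    by move=> /(pcan_inj pickleK)[-> ->].
(* Adjoining [G0] keeps the domain infinite and makes the empty chain harmless. *)
have [F FP Ftot|A [AP Amax]] :=
    @Zorn_bigcup _ [set G | square_inj X (G `|` G0)].
  rewrite /=; set H := _ `|` G0.
  (* Each clause of [square_inj] involves at most two given triples, so it passes to the union once
     these lie in a common member. *)
  have two w w' : H w -> H w' -> exists G,
      [/\ square_inj X G, G `<=` H, G w & G w'].
    have FH G : F G -> G `|` G0 `<=` H.
      by move=> FG v [Gv|]; [left; exists G|right].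
    move=> [[G FG Gw]|Gw] [[G' FG' Gw']|Gw'].
    - have [GG'|G'G] := Ftot _ _ FG FG'.
        exists (G' `|` G0); split; [exact: FP|exact: FH|left; exact: GG'|by left].
      exists (G `|` G0); split; [exact: FP|exact: FH|by left|left; exact: G'G].
    - exists (G `|` G0); split; [exact: FP|exact: FH|by left|by right].
    - exists (G' `|` G0); split; [exact: FP|exact: FH|by right|by left].
    - by exists G0; split=> // v; right.
  have domS (G : set (T * T * T)) : G `<=` H -> square_dom G `<=` square_dom H.
    by move=> GH x [z /GH]; exists z.
  split.
  - move=> x [z Hz]; have [G [[GX _ _ _ _] _ Gz _]] := two _ _ Hz Hz.
    by apply: GX; exists z.
  - move=> x y [z Hz] [z' Hz'].
    have [G [[_ Gtot _ _ _] GH Gz Gz']] := two _ _ Hz Hz'.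
    have [||t Gt] := Gtot x y; [by exists z|by exists z'|].
    by exists t; exact: GH.
  - move=> x y z Hz; have [G [[_ _ Gd _ _] GH Gz _]] := two _ _ Hz Hz.
    by have [dx dy dz] := Gd _ _ _ Gz; split; exact: domS GH _ _.
  - move=> p z z' Hz Hz'; have [G [[_ _ _ Gf _] GH Gz Gz']] := two _ _ Hz Hz'.
    exact: Gf Gz Gz'.
  - move=> p p' z Hz Hz'; have [G [[_ _ _ _ Gi] GH Gz Gz']] := two _ _ Hz Hz'.
    exact: Gi Gz Gz'.
move: AP => /=; set G := A `|` G0 => AP; pose B := square_dom G.
have iB n : B (i n) by have [z] := domG0 n; exists z; right.
have Binf : infinite_set B.
  by apply/infiniteP/card_leP_fun; exists i; split=> // m n _ _; exact: iinj.
have [|XB] := card_le_total B (X `\` B).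
  move=> /(square_inj_extend _ _ AP Binf)[G' [G'P GG' G'G]].
  case: (Amax G'); last by rewrite /= setUidl// => w ?; apply: GG'; right.
  split; first by move=> w Aw; apply: GG'; left.
  by apply: contra_not G'G => G'A w /G'A; left.
have [BX Gtot GB _ Ginj] := AP.
have BB : B `*` B #<= B.
  have /choice[p pP] (xy : T * T) : exists z, B xy.1 -> B xy.2 -> G (xy, z).
    have [[Bx By]|nB] := pselect (B xy.1 /\ B xy.2).
      by have [z Gz] := Gtot _ _ Bx By; exists z => _ _; case: xy Bx By Gz.
    by exists point => Bx By; case: nB.
  apply/card_leP_fun; exists p; split.
    by move=> [x y] [/= Bx By]; have /(_ Bx By)/GB[] := pP (x, y).
  move=> xy xy' [Bx By] [Bx' By'] e; have h := pP _ Bx By.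
  by apply: Ginj h _; rewrite e; exact: pP.
suff /card_leP_fun[k [kB kinj]] : X #<= B.
  apply: card_le_trans (card_le_trans BB (subset_card_le BX)).
  apply/card_leP_fun; exists (fun w => (k w.1, k w.2)); split.
    by move=> [x y] [Xx Xy]; split; exact: kB.
  move=> [x y] [x' y'] [/= Xx Xy] [/= Xx' Xy'] [/kinj xe /kinj ye].
  by rewrite xe// ye.
apply: card_le_trans BB; have /card_leP_fun[k [kB kinj]] := XB.
apply/card_leP_fun.
exists (fun x => if pselect (B x) then (x, i 0%N) else (k x, i 1%N)); split.
  by move=> x Xx; case: pselect => Bx; split=> //=; apply: kB.
move=> x y Xx Xy; case: pselect => Bx; case: pselect => By [].
- by [].
- by move=> _ /iinj.
- by move=> _ /iinj.
- by move=> /kinj; apply.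
Qed.

(** Iterated pairing is injective only among lists of equal length, since the end marker [i 0] may
    itself be a pair; the length is therefore coded as well. *)
Lemma card_le_seq_infinite {T : pointedType} (X : set T) : infinite_set X ->
  [set s : seq T | {in s, forall x, X x}] #<= X.
Proof.
move=> Xinf; have /card_leP_fun[i [iX iinj]] := (infiniteP _).1 Xinf.
have /card_leP_fun[p [pX pinj]] := card_le_setX_infinite _ Xinf.
pose code := foldr (fun x c => p (x, c)) (i 0%N).
have codeX s : {in s, forall x, X x} -> X (code s).
  elim: s => [_|x s IH xsX] /=; first exact: iX.
  apply: pX; split=> /=; first by apply: xsX; rewrite mem_head.
  by apply: IH => y ys; apply: xsX; rewrite in_cons ys orbT.
apply/card_leP_fun; exists (fun s => p (i (size s), code s)); split.
  by move=> s sX; apply: pX; split; [exact: iX|exact: codeX].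
move=> s t sX tX /pinj e.
have [] := e (conj (iX _ I) (codeX _ sX)) (conj (iX _ I) (codeX _ tX)).
move=> /iinj - /(_ I I); elim: s t sX tX {e} => [[]//|x s IH [//|y t]] sX tX.
have sX' : {in s, forall x, X x}.
  by move=> z zs; apply: sX; rewrite in_cons zs orbT.
have tX' : {in t, forall x, X x}.
  by move=> z zs; apply: tX; rewrite in_cons zs orbT.
have Xx : X x by apply: sX; rewrite mem_head.
have Xy : X y by apply: tX; rewrite mem_head.
move=> [st] /=.
move=> /pinj - /(_ (conj Xx (codeX _ sX')) (conj Xy (codeX _ tX')))[-> ].
by move=> /IH ->.
Qed.

(** * From a failure of S_1(Gamma,Omega) to a dominating family *)

Lemma finite_set_nat_bounded (A : set nat) :
  finite_set A -> exists N, forall k, A k -> (k <= N)%N.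
Proof.
move=> /finite_seqP[s ->]; exists (\max_(k <- s) k)%N => k /= ks.
exact: (leq_bigmax_seq (F := fun k => k)).
Qed.

(** Every member other than [X] misses a point, and each point is missed by finitely many
    members. *)
Lemma gamma_cover_infinite {R : realType} (X : set R) Us :
  gamma_cover X Us -> infinite_set X.
Proof.
move=> [[_ Uopen Ucover] Uinf Ufin] Xfin; apply: Uinf.
apply: (@sub_finite_set _ _
  ([set X] `|` \bigcup_(x in X) [set U | Us U /\ ~ U x])); last first.
  by rewrite finite_setU; split; [exact: finite_set1|exact: bigcup_finite].
move=> U UsU; have [XU|/existsNP[x /not_implyP[Xx nUx]]] :=
  pselect (forall x, X x -> U x); last by right; exists x.
left; apply/seteqP; split; last exact: XU.
by have [W _ ->] := Uopen _ UsU; exact: subIsetl.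
Qed.

(* The members other than X are enumerated injectively, so a given point lies
   in all but finitely many terms. *)
Lemma gamma_cover_seq {R : realType} (X : set R) Us : gamma_cover X Us ->
  exists e : nat -> set R,
    [/\ forall k, Us (e k), forall k, e k <> X
      & forall x, X x -> exists N, forall k, (N <= k)%N -> e k x].
Proof.
move=> [_ Uinf Ufin].
have : infinite_set (Us `\ X).
  by apply: infinite_setD => //; exact: finite_set1.
move=> /infiniteP/card_leP_fun[e [eU einj]].
exists e; split=> [k|k|x Xx]; [by have [] := eU k I|by have [] := eU k I|].
have /finite_set_nat_bounded[N HN] : finite_set [set k | ~ e k x].
  have <- : e @^-1` [set U | Us U /\ ~ U x] = [set k | ~ e k x].
    apply/seteqP; split=> k /=; first by case.
    by move=> ?; split=> //; have [] := eU k I.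
  by apply: finite_preimage (Ufin _ Xx) => k l _ _; exact: einj.
exists N.+1 => k Nk; apply: contrapT => /HN.
by rewrite leqNgt Nk.
Qed.

Lemma dominating_of_not_S1 {R : realType} (X : set R) : ~ S1_Gamma_Omega X ->
  infinite_set X /\
  exists2 D, dominating D & D #<= [set s : seq R | {in s, forall x, X x}].
Proof.
move=> /existsNP[Us /not_implyP[UsG noU]]; split.
  exact: gamma_cover_infinite (UsG 0%N).
have /choice[e eP] n := gamma_cover_seq _ _ (UsG n).
have /choice[f fP] (xn : R * nat) : exists N,
    X xn.1 -> forall k, (N <= k)%N -> e xn.2 k xn.1.
  case: xn => x n; have [Xx|nXx] := pselect (X x); last by exists 0%N.
  by have [_ _ /(_ _ Xx)[N HN]] := eP n; exists N.
pose h s n := (\max_(x <- s) f (x, n))%N.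
pose XS := [set s : seq R | {in s, forall x, X x}].
exists [set h s | s in XS]; last exact: card_image_le.
move=> g; apply: contrapT => nodom; apply: noU.
exists (fun n => e n (g n)) => [n|]; first by have [] := eP n.
(* If the list [s] lies in no chosen set, then [g n <= h s n] for every [n], so [h s] dominates
   [g]. *)
have fin F : finite_set F -> F `<=` X -> exists n, F `<=` e n (g n).
  move=> /finite_seqP[s ->] sX; apply: contrapT => noF; apply: nodom.
  exists (h s); first by exists s.
  apply: nearW => n; rewrite leqNgt; apply/negP => hg; apply: noF; exists n.
  move=> x /= xs; apply: (fP (x, n)) => /=; first exact: sX.
  apply: leq_trans (ltnW hg).
  exact: (leq_bigmax_seq (F := fun x => f (x, n))).
have eopen n : relatively_open X (e n (g n)).
  by have [eU _ _] := eP n; have [[_ + _] _ _] := UsG n; apply.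
split.
- split; first exact: card_image_le.
  + by move=> _ [n _ <-].
  + apply/seteqP; split=> [x [_ [n _ <-]]|x Xx].
      by have [W _ ->] := eopen n; case.
    have [|n /(_ x erefl) ex] := fin [set x] (finite_set1 x); first by move=> _ ->.
    by exists (e n (g n)) => //; exists n.
- by move=> [n _]; have [_ /(_ (g n))] := eP n.
- move=> F Ff /(fin _ Ff)[n Fn].
  by exists (e n (g n)) => //; exists n.
Qed.

(** * From a dominating family to a set of reals failing S_1(Gamma,Omega) *)

(* [x b] is the real with base-4 digits [b]; its digit [i] is recognised by the
   position of [4 ^ i * x b] between two consecutive integers: within [0, 1/12]
   of the lower one if [b i = 0], and within [1/4, 1/3] of it if [b i = 1]. *)
Lemma base4_embedding (R : realType) :
  exists (x : (nat -> bool) -> R) (W : nat -> set R),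
    (forall i, open (W i)) /\ forall b i, W i (x b) <-> b i.
Proof.
pose S (b : nat -> bool) n : R := \sum_(i < n) (b i)%:R / 4 ^+ i.+1.
(* The value of the tail from digit [n] on when all its digits are 1. *)
pose c n : R := 3^-1 / 4 ^+ n.
have c0 n : 0 < c n by rewrite divr_gt0// exprn_gt0.
have cS n : c n = c n.+1 + (4 ^+ n.+1)^-1.
  rewrite /c exprS; field; rewrite expf_neq0//; lra.
have SS b n : S b n.+1 = S b n + (b n)%:R / 4 ^+ n.+1 by rewrite /S big_ord_recr.
have bit (b : nat -> bool) n :
    0 <= (b n)%:R / 4 ^+ n.+1 :> R /\ (b n)%:R / 4 ^+ n.+1 <= (4 ^+ n.+1)^-1 :> R.
  by case: (b n); rewrite ?mul0r ?mul1r lexx invr_ge0 exprn_ge0.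
have Smono b m n : (m <= n)%N -> S b m <= S b n.
  move=> /subnK <-; elim: (n - m)%N => [//|k]; rewrite addSn SS.
  have [] := bit b (k + m)%N; lra.
have Scmono b m n : (m <= n)%N -> S b n + c n <= S b m + c m.
  move=> /subnK <-; elim: (n - m)%N => [//|k]; rewrite addSn SS.
  have [] := bit b (k + m)%N; have := cS (k + m)%N; lra.
have Sub b n m : S b m <= S b n + c n.
  have [mn|/ltnW nm] := leqP m n; first by have := Smono b _ _ mn; have := c0 n; lra.
  by have := Scmono b _ _ nm; have := c0 m; lra.
pose x b := sup (range (S b)).
have xlb b n : S b n <= x b.
  apply: ub_le_sup; last by exists n.
  by exists (S b 0%N + c 0%N) => _ [m _ <-].
have xub b n : x b <= S b n + c n.
  by apply: ge_sup => [|_ [m _ <-]//]; exists (S b 0%N), 0%N.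
have Sint b n : exists k : nat, 4 ^+ n * S b n = k%:R.
  elim: n => [|n [k kE]]; first by exists 0%N; rewrite /S big_ord0 mulr0.
  exists (4 * k + b n)%N; rewrite SS mulrDr exprS -mulrA kE natrD natrM.
  by rewrite -exprS mulrCA divff ?expf_neq0// ?mulr1.
(* The threshold 1/6 separates 1/12 from 1/4. *)
pose W n := \bigcup_(k in [set: nat])
  (fun y : R => 4 ^+ n * y) @^-1` `]k%:R + 6^-1, k.+1%:R[%classic.
exists x, W; split=> [n|b n].
  apply: bigcup_open => k _; apply: open_comp; last exact: interval_open.
  by move=> y _; apply: mulrl_continuous.
have [N NE] := Sint b n.
have [p0 pn] : 0 < 4 ^+ n :> R /\ 4 ^+ n != 0 :> R.
  by split; [exact: exprn_gt0|exact: expf_neq0].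
have lo : N%:R + (b n)%:R / 4 <= 4 ^+ n * x b.
  have -> : N%:R + (b n)%:R / 4 = 4 ^+ n * S b n.+1.
    by rewrite SS mulrDr NE exprS; field.
  by rewrite ler_pM2l.
have hi : 4 ^+ n * x b <= N%:R + (b n)%:R / 4 + 12^-1.
  have -> : N%:R + (b n)%:R / 4 + 12^-1 = 4 ^+ n * (S b n.+1 + c n.+1).
    by rewrite SS !mulrDr NE /c exprS; field.
  by rewrite ler_pM2l.
split.
- move=> [k _ /=]; rewrite in_itv /= => /andP[klt ltk].
  apply/negPn/negP => nb; move: lo hi; rewrite (negbTE nb) !mul0r !addr0 => lo hi.
  have kN : (k <= N)%N.
    by rewrite -ltnS -(ltr_nat R) -natr1; lra.
  have Nk : (N <= k)%N by rewrite -ltnS -(ltr_nat R); lra.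
  have e : k = N by apply/eqP; rewrite eqn_leq kN.
  move: klt; rewrite e; lra.
- move=> bn; exists N => //=; rewrite in_itv /= -(natr1 N).
  by move: lo hi; rewrite bn !mul1r => lo hi; apply/andP; split; lra.
Qed.

Lemma not_S1_of_dominating (R : realType) (D : set (nat -> nat)) :
  dominating D -> exists2 X : set R, ~ S1_Gamma_Omega X & X #<= D.
Proof.
move=> Ddom; have [x [W [Wopen WP]]] := base4_embedding R.
pose b (f : nat -> nat) i := if unpickle i is Some (n, k) then (f n <= k)%N else false.
pose r f := x (b f).
exists (r @` D); last exact: card_image_le.
set X := r @` D; pose U (n k : nat) := X `&` W (pickle (n, k)).
have UP n k f : D f -> U n k (r f) <-> (f n <= k)%N.
  move=> Df; rewrite /U /= /r WP /b pickleK.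
  by split=> [[]//|]; split=> //; exists f.
have UX n k : U n k `<=` X by exact: subIsetl.
(* A member of [D] eventually above [c + 1] shows that [D] is bounded at only finitely many
   coordinates. *)
have [N DN] : exists N, forall n, (N <= n)%N -> forall k, exists2 f, D f & (k < f n)%N.
  have /choice[c cP] n : exists c, (forall f, D f -> (f n <= c)%N) \/
      forall k, exists2 f, D f & (k < f n)%N.
    have [[c cP]|noc] := pselect (exists c, forall f, D f -> (f n <= c)%N).
      by exists c; left.
    exists 0%N; right => k; apply: contrapT => nof; apply: noc; exists k => f Df.
    by rewrite leqNgt; apply/negP => ?; apply: nof; exists f.
  have [f Df [N _ fN]] := Ddom (fun n => (c n).+1).
  exists N => n Nn; case: (cP n) => // /(_ _ Df); rewrite leqNgt.
  by have /= -> := fN n Nn.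
have Uneq n k : (N <= n)%N -> exists2 y, X y & ~ U n k y.
  move=> /DN/(_ k)[f Df kf]; exists (r f); first by exists f.
  by rewrite UP//; apply/negP; rewrite -ltnNge.
move=> S1X; have [|V VU [_ VX Vomega]] := S1X (fun n => range (U (N + n)%N)).
  move=> n; split.
  - split; first exact: card_image_le.
    + by move=> _ [k _ <-]; exists (W (pickle ((N + n)%N, k))).
    + apply/seteqP; split=> [y [_ [k _ <-]]|_ [f Df <-]]; first exact: UX.
      by exists (U (N + n)%N (f (N + n)%N)); [exists (f (N + n)%N)|apply/UP].
  - move=> /finite_seqP[s sE].
    have /choice[m mP] A : exists m, range (U (N + n)%N) A ->
        exists2 f, D f & ~ A (r f) /\ (f (N + n)%N <= m)%N.
      have [[k _ <-]|nA] := pselect (range (U (N + n)%N) A); last by exists 0%N.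
      have [_ [f Df <-] nU] := Uneq _ k (leq_addr n N).
      by exists (f (N + n)%N) => _; exists f.
    (* Each listed member [A] misses some [r f] with [f (N + n) <= m A <= K], and [U (N + n) K]
       contains that point, so it is not in the list. *)
    pose K := (\max_(A <- s) m A)%N.
    have sU : U (N + n)%N K \in s.
      have : [set` s] (U (N + n)%N K) by rewrite -sE; exists K.
      by [].
    have [|f Df [nUf fm]] := mP (U (N + n)%N K); first by exists K.
    apply: nUf; apply/UP => //; apply: leq_trans fm _.
    exact: (leq_bigmax_seq (F := m)).
  - move=> _ [f Df <-].
    apply: (@sub_finite_set _ _ (U (N + n)%N @` `I_(f (N + n)%N))); last first.
      exact/finite_image/finite_II.
    move=> _ [[k _ <-] nU]; exists k => //=.
    by rewrite ltnNge; apply/negP => fk; apply/nU/UP.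
have /choice[g gP] n : exists k, U (N + n)%N k = V n by have [k _ <-] := VU n; exists k.
(* The shift by [N] matches [V n = U (N + n) (g n)]; the successor keeps [r f] out of [V n] once
   [N + n >= M]. *)
have [f Df [M _ fM]] := Ddom (fun n => (g (n - N)%N).+1).
have /choice[y yP] n : exists y, X y /\ ~ V n y.
  by have [y Xy nU] := Uneq _ (g n) (leq_addr n N); exists y; rewrite -gP.
have [||_ [n _ <-] FV] := Vomega ([set r f] `|` y @` `I_M).
- rewrite finite_setU; split; first exact: finite_set1.
  exact/finite_image/finite_II.
- by move=> _ [->|[n _ <-]]; [exists f|have [] := yP n].
have [nM|Mn] := ltnP n M.
  by have [_] := yP n; apply; apply: FV; right; exists n.
have : V n (r f) by apply: FV; left.
rewrite -gP => /UP - /(_ Df); rewrite leqNgt.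
have /= := fM (N + n)%N (leq_trans Mn (leq_addl _ _)).
by rewrite addKn => ->.
Qed.

Theorem mainTheorem4 (R : realType) :
  exists kappa : set (nat -> nat),
    is_min_card [set D | dominating D] kappa /\
    is_min_card [set X : set R | ~ S1_Gamma_Omega X] kappa.
Proof.
have [|K Kdom Kmin] := @card_min_exists _ [set D | dominating D].
  by exists setT => g; exists g => //; apply: nearW => n.
exists K; split; first by split=> //; exists K => //; exact: card_eqxx.
have minX (X : set R) : ~ S1_Gamma_Omega X -> K #<= X.
  move=> /dominating_of_not_S1[Xinf [D Ddom DX]].
  exact: card_le_trans (card_le_trans (Kmin _ Ddom) DX) (card_le_seq_infinite _ Xinf).
(* The coding only gives a set of size at most that of [K]; [minX] supplies the reverse
   inequality. *)
split=> //; have [X XS XK] := not_S1_of_dominating R _ Kdom.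
by exists X => //; rewrite card_eq_le XK minX.
Qed.
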